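(* Let $\mathcal{H}$ be a separable Hilbert space, $K\in B(\mathcal{H})$, and let $F=\{f_i\}_{i\in I}$ be a Parseval $K$-frame for $\mathcal{H}$. For every $f\in\mathcal{H}$, every $J\subseteq I$ and every $E\subseteq J^c$, $$\left\Vert\sum_{i\in J\cup E}\langle f,f_i\rangle f_i\right\Vert^2-\left\Vert\sum_{i\in J^c\setminus E}\langle f,f_i\rangle f_i\right\Vert^2=\left\Vert\sum_{i\in J}\langle f,f_i\rangle f_i\right\Vert^2-\left\Vert\sum_{i\in J^c}\langle f,f_i\rangle f_i\right\Vert^2+2\,\mathrm{Re}\sum_{i\in E}\langle f,f_i\rangle\,\overline{\langle KK^*f,f_i\rangle}.$$
   Context: $B(\mathcal{H})$ is the set of bounded linear operators on $\mathcal{H}$, $I$ is a countable index set, $J^c=I\setminus J$, and the inner product is linear in the first variable. A sequence $\{f_i\}_{i\in I}\subseteq\mathcal{H}$ is a Parseval $K$-frame for $\mathcal{H}$ if $\sum_{i\in I}|\langle f,f_i\rangle|^2=\Vert K^*f\Vert^2$ for all $f\in\mathcal{H}$. *)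

(* Defs.v *)
From HB Require Import structures.
From mathcomp Require Export all_boot all_order all_algebra.
From mathcomp Require Export finmap.
From mathcomp Require Export sesquilinear.
From mathcomp Require Export complex.
From mathcomp Require Export boolp classical_sets cardinality reals topology.
From mathcomp Require Export normedtype summability.
Set Implicit Arguments.
Unset Strict Implicit.
Unset Printing Implicit Defensive.
Import Order.TTheory GRing.Theory Num.Theory numFieldNormedType.Exports.
Local Open Scope classical_set_scope.
Local Open Scope ring_scope.

Section UnconditionalSums.
Context {C : numFieldType} {V : normedModType C} {I : choiceType}.
Implicit Types (J : set I) (x : I -> V) (v : V).

(* The net of partial sums of x over J, indexed by the finite subsets of I
   ordered by inclusion (the filter [totally]): sums over an index set
   without a distinguished enumeration are limits of this net. *)
Definition partial_sum_on J x (A : {fset I}) : V :=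
  \sum_(i <- A | i \in J) x i.

Definition has_sum J x v : Prop := partial_sum_on J x @ totally --> v.

Definition summable_on J x : Prop := cvg (partial_sum_on J x @ totally).

(* Meaningful only when summable_on J x holds. *)
Definition sum_on J x : V := lim (partial_sum_on J x @ totally).

End UnconditionalSums.

Definition separable (T : topologicalType) : Prop :=
  exists D : set T, countable D /\ dense D.

Section HilbertSpace.
Context {R : realType} {H : completeNormedModType R[i]}.

(* [dot] is linear in its first variable, conjugate-linear in the second and
   positive definite; this says that it induces the norm of H. *)
Definition induces_norm (dot : {dot H for Num.conj}) : Prop :=
  forall x : H, dot x x = `|x| ^+ 2.

Definition bounded_operator (K : {linear H -> H}) : Prop :=
  exists M : R[i], forall x : H, `|K x| <= M * `|x|.

(* K^* y is the vector z such that <K x, y> = <x, z> for all x; it exists and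
   is unique, by Riesz representation, when K is bounded. *)
Definition adjoint (dot : {dot H for Num.conj}) (K : {linear H -> H}) (y : H)
    : H :=
  xget 0 [set z | forall x, dot (K x) y = dot x z].

Definition parseval_K_frame (dot : {dot H for Num.conj}) (K : {linear H -> H})
    (I : countType) (F : I -> H) : Prop :=
  forall f : H,
    has_sum setT (fun i => `|dot f (F i)| ^+ 2) (`|adjoint dot K f| ^+ 2).

End HilbertSpace.

(* Main.v *)
Require Import Defs.
From mathcomp Require Import ring lra.
Set Implicit Arguments.
Unset Strict Implicit.
Unset Printing Implicit Defensive.
Import Order.TTheory GRing.Theory Num.Theory numFieldNormedType.Exports.
Local Open Scope classical_set_scope.
Local Open Scope ring_scope.

(** Write [s = K K^* f] and, for a set [D] of indices, let [S_D] be the sum of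
    [<f,f_i> f_i] over [D]. The identity is elementary once two facts are known:
    every [S_D] converges, and the sum over all indices is [s].

    Convergence. The Parseval condition and the boundedness of [K^*] give the
    Bessel inequality [sum |<g,f_i>|^2 <= B |g|^2], and hence, for finite [A],
    [|sum_A <f,f_i> f_i|^2 <= B sum_A |<f,f_i>|^2] ([frame_partial_sum_le]).
    As [sum |<f,f_i>|^2] converges, the net of partial sums over any [D] is
    Cauchy ([frame_sum_summable]).

    Value ([parseval_frame_operator]). The frame operator [S] sending [f] to the
    full sum satisfies [<S f, f> = sum |<f,f_i>|^2 = |K^* f|^2 = <K K^* f, f>].
    So [S - K K^*] is linear with vanishing quadratic form, and over the complex
    numbers polarisation makes it zero ([eq0_of_dot_diag]). That [K^*] satisfies
    [<K x, y> = <x, K^* y>] at all is the Riesz representation theorem,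
    proved below by minimising [|x|^2 - 2 Re phi(x)].

    Conclusion. With [a], [b], [d] the sums over [J], [E] and the remaining
    indices, [s = a + b + d], the sum over [E] on the right-hand side is [<b, s>],
    and both sides equal [|a|^2 + |b|^2 - |d|^2 + 2 Re <a, b>]. *)

(** * Unconditional sums *)

#[local] Existing Instance totally_filter.

Section UnconditionalSums.
Context {C : numFieldType} {V : normedModType C} {I : choiceType}.
Implicit Types (J E : set I) (x : I -> V) (v w : V).

Lemma has_sum_sum_on J x v : has_sum J x v -> sum_on J x = v.
Proof. by move=> xv; apply: cvg_lim xv; exact: norm_hausdorff. Qed.

Lemma has_sum_unique J x v w : has_sum J x v -> has_sum J x w -> v = w.
Proof. by move=> /has_sum_sum_on <- /has_sum_sum_on. Qed.

Lemma has_sumZD J x y a v w : has_sum J x v -> has_sum J y w ->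
  has_sum J (fun i => a *: x i + y i) (a *: v + w).
Proof.
move=> xv yw; rewrite /has_sum.
rewrite [partial_sum_on _ _](_ : _ =
    fun A => a *: partial_sum_on J x A + partial_sum_on J y A); last first.
  by apply/funext => A; rewrite /partial_sum_on big_split -scaler_sumr.
by apply: cvgD => //; exact: cvgZl_tmp.
Qed.

Lemma has_sumU J E x v w : [disjoint J & E] -> has_sum J x v -> has_sum E x w ->
  has_sum (J `|` E) x (v + w).
Proof.
move=> /disj_setPS JE xv xw; rewrite /has_sum.
rewrite [partial_sum_on _ _](_ : _ =
    fun A => partial_sum_on J x A + partial_sum_on E x A).
  exact: cvgD.
apply/funext => A; rewrite /partial_sum_on /=.
rewrite [X in _ = X + _]big_mkcond [X in _ = _ + X]big_mkcond -big_split /=.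
rewrite big_mkcond; apply: eq_bigr => i _.
rewrite in_setU.
have [/set_mem iJ|_] := boolP (i \in J); have [/set_mem iE|_] := boolP (i \in E).
- by case: (JE i).
- by rewrite addr0.
- by rewrite add0r.
- by rewrite addr0.
Qed.

(** The difference of two nested partial sums is again a sum over a finite set
    filtered by a predicate; this is the shape in which the Bessel-type estimate
    controls the oscillation of the net. *)
Lemma partial_sum_on_fsubset J x (A B : {fset I}) : (A `<=` B)%fset ->
  partial_sum_on J x B - partial_sum_on J x A =
  \sum_(i <- B | (i \in J) && (i \notin A)) x i.
Proof.
move=> AB; rewrite /partial_sum_on (bigID (mem A)) /= addrC.
rewrite [X in _ - X](_ : _ = \sum_(i <- B | (i \in J) && (i \in A)) x i).
  by rewrite addrK.
rewrite big_mkcond [RHS]big_mkcond /=.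
rewrite (eq_big_seq (fun i => if (i \in J) && (i \in A) then x i else 0)).
  by apply: big_fset_incl => // i _ /negbTE ->; rewrite andbF.
by move=> i ->; rewrite andbT.
Qed.

Lemma has_sumP J x v : has_sum J x v <->
  forall e : C, 0 < e -> exists A, forall B : {fset I}, (A `<=` B)%fset ->
    `|v - partial_sum_on J x B| < e.
Proof.
split=> [/cvgrPdist_lt xv e /xv[A _ Av]|xv]; first by exists A.
by apply/cvgrPdist_lt => e /xv[A Av]; exists A.
Qed.
End UnconditionalSums.

(** Partial sums of nonnegative terms increase along the net, so none can exceed
    the limit. The scalars are only partially ordered: comparing a partial sum
    with the limit through the modulus of their difference takes a real limit. *)
Lemma has_sum_ge_partial (C : numFieldType) (I : choiceType) (J : set I)
    (x : I -> C) (s : C) (A : {fset I}) :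
  (forall i, 0 <= x i) -> s \is Num.real -> has_sum J x s ->
  partial_sum_on J x A <= s.
Proof.
move=> x0 sR /has_sumP xs; apply/ler_addgt0Pr => e /xs[B Bs].
have := Bs (A `|` B)%fset (fsubsetUr _ _).
have p0 D : 0 <= partial_sum_on J x D by apply: sumr_ge0.
rewrite real_ltr_norml; last by rewrite realB // ger0_real.
case/andP=> + _; rewrite ltrBrDl ltrBlDr => /ltW; apply: le_trans.
rewrite -subr_ge0 (partial_sum_on_fsubset _ _ (fsubsetUl _ _)).
exact: sumr_ge0.
Qed.

(** * Inner products inducing the norm *)

Section InnerProduct.
Context {R : realType} {H : completeNormedModType R[i]}.
Variable dot : {dot H for Num.conj}.
Hypothesis hdot : induces_norm dot.
Implicit Types (x y z : H) (a : R[i]).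

Lemma dotC x y : dot x y = (dot y x)^*.
Proof. by rewrite hermC mul1r. Qed.

Lemma dotZl a x y : dot (a *: x) y = a * dot x y.
Proof. exact: linearZl_LR. Qed.

Lemma dotZr a x y : dot x (a *: y) = a^* * dot x y.
Proof. exact: linearZr_LR. Qed.

Lemma dotDl x y z : dot (x + y) z = dot x z + dot y z.
Proof. exact: linearDl. Qed.

Lemma dotDr x y z : dot x (y + z) = dot x y + dot x z.
Proof. exact: linearDr. Qed.

Lemma dotBl x y z : dot (x - y) z = dot x z - dot y z.
Proof. exact: linearBl. Qed.

Lemma dotBr x y z : dot x (y - z) = dot x y - dot x z.
Proof. exact: linearBr. Qed.

Lemma dot_normC x y : `|dot x y| ^+ 2 = dot x y * dot y x.
Proof. by rewrite normCK -dotC. Qed.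

Lemma dot_ge0 x : 0 <= dot x x.
Proof. by rewrite hdot exprn_ge0. Qed.

Lemma dot_inj x y : (forall z, dot z x = dot z y) -> x = y.
Proof.
move=> xy; apply/eqP; rewrite -subr_eq0 -normr_eq0 -sqrf_eq0 -hdot.
by rewrite dotBr xy subrr.
Qed.

(** Expand the nonnegative number [<w, w>] for [w = <y,y> x - <x,y> y]; this is
    [<y,y>] times the defect of the squared inequality. *)
Lemma Cauchy_Schwarz x y : `|dot x y| <= `|x| * `|y|.
Proof.
have [->|y0] := eqVneq y 0.
  by rewrite [dot _ _]linear0r !normr0 mulr0.
have Y0 : 0 < dot y y by rewrite hdot exprn_gt0 ?normr_gt0.
rewrite -ler_sqr ?nnegrE ?mulr_ge0// exprMn -!hdot dot_normC.
have := dot_ge0 (dot y y *: x - dot x y *: y).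
rewrite !(dotBl, dotBr, dotZl, dotZr) -!dotC.
rewrite (_ : _ - _ = dot y y * (dot x x * dot y y - dot x y * dot y x)).
  by rewrite pmulr_rge0 ?subr_ge0.
by ring.
Qed.

Lemma cvg_dotl {T : Type} {F : set_system T} {FF : Filter F} (u : T -> H) x y :
  u @ F --> x -> dot (u t) y @[t --> F] --> dot x y.
Proof.
move=> /cvgrPdist_lt ux; apply/cvgrPdist_lt => e e0.
have y0 : 0 < `|y| + 1 :> R[i] by rewrite ltr_wpDl.
have := ux (e / (`|y| + 1)) (divr_gt0 e0 y0).
apply: filterS => t; rewrite ltr_pdivlMr// => xt.
rewrite -dotBl; apply: le_lt_trans (Cauchy_Schwarz _ _) _.
by apply: le_lt_trans xt; rewrite ler_wpM2l// lerDl.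
Qed.

Lemma cvg_dotr {T : Type} {F : set_system T} {FF : Filter F} (u : T -> H) x y :
  u @ F --> y -> dot x (u t) @[t --> F] --> dot x y.
Proof.
move=> /cvgrPdist_lt ux; apply/cvgrPdist_lt => e e0.
have y0 : 0 < `|x| + 1 :> R[i] by rewrite ltr_wpDl.
have := ux (e / (`|x| + 1)) (divr_gt0 e0 y0).
apply: filterS => t; rewrite ltr_pdivlMr// => xt.
rewrite -dotBr; apply: le_lt_trans (Cauchy_Schwarz _ _) _.
by apply: le_lt_trans xt; rewrite mulrC ler_wpM2l// lerDl.
Qed.

Lemma has_sum_dotl (I : choiceType) (J : set I) (x : I -> H) v y :
  has_sum J x v -> has_sum J (fun i => dot (x i) y) (dot v y).
Proof.
move=> /cvg_dotl-/(_ y) xv; rewrite /has_sum.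
rewrite [partial_sum_on _ _](_ : _ = fun A => dot (partial_sum_on J x A) y) //.
by apply/funext => A; rewrite /partial_sum_on linear_sumlz.
Qed.

(** Polarisation: with [y = D x], expanding [<D (a y + x), a y + x> = 0] leaves
    [a <D y, x> + conj(a) <y, y> = 0] for every scalar [a], and the choices [1] and
    ['i] force [<y, y> = 0]. The argument is genuinely complex: a real rotation by
    a right angle is nonzero with vanishing quadratic form. *)
Lemma eq0_of_dot_diag (D : H -> H) :
  linear D -> (forall x, dot (D x) x = 0) -> forall x, D x = 0.
Proof.
move=> Dlin D0 x; set y := D x.
have pol a : a * dot (D y) x + a^* * dot y y = 0.
  have := D0 (a *: y + x); rewrite Dlin !(dotDl, dotDr, dotZl, dotZr) !D0 -/y.
  by rewrite !mulr0 add0r addr0.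
have e1 : dot (D y) x + dot y y = 0 by rewrite -(pol 1) rmorph1 !mul1r.
have : 'i * (dot (D y) x - dot y y) = 0 by rewrite mulrBr -mulNr -conjCi pol.
move=> /eqP; rewrite mulf_eq0 (negbTE (neq0Ci _)) /= subr_eq0 => /eqP e2.
move: e1; rewrite e2 -mulr2n => /eqP; rewrite mulrn_eq0 /= hdot sqrf_eq0.
by rewrite normr_eq0 => /eqP.
Qed.
End InnerProduct.

(** * Riesz representation *)

Section Riesz.
Context {R : realType} {H : completeNormedModType R[i]}.
Variable dot : {dot H for Num.conj}.
Hypothesis hdot : induces_norm dot.
Implicit Types (x y z : H).

Section Energy.
Variables (phi : H -> R[i]) (M : R[i]).
Hypothesis phi_lin : scalar phi.
Hypothesis M_ge0 : 0 <= M.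
Hypothesis phi_le : forall x, `|phi x| <= M * `|x|.

(** The functional [|x|^2 - 2 Re phi(x)], whose minimiser is the vector
    representing [phi]: it equals [|x - z|^2 - |z|^2] when [phi = <., z>]. *)
Definition energy x : R := complex.Re (dot x x - (phi x + (phi x)^*)).

Lemma energyE x : (energy x)%:C%C = dot x x - (phi x + (phi x)^*).
Proof.
by apply: RRe_real; rewrite CrealE !(rmorphB, rmorphD) /= conjCK -dotC [_ + phi x]addrC.
Qed.

(** Since [2 Re phi(x) <= 2 M |x|], the energy is at least
    [(|x| - M)^2 - M^2 >= - M^2]. *)
Lemma energy_lbound : has_inf (range energy).
Proof.
split; first by exists (energy 0), 0.
exists (- complex.Re M ^+ 2) => _ [x _ <-].
rewrite -lecR energyE hdot.
have ReM : (complex.Re M)%:C%C = M by apply: RRe_real; exact: ger0_real.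
rewrite rmorphN rmorphXn /= ReM.
have le2 : phi x + (phi x)^* <= 2 * (M * `|x|).
  have rl : phi x + (phi x)^* \is Num.real.
    by rewrite CrealE rmorphD /= conjCK addrC.
  apply: le_trans (real_ler_norm rl) (le_trans (ler_normD _ _) _).
  by rewrite norm_conjC mulrDl mul1r lerD.
apply: le_trans (lerB (lexx _) le2).
rewrite -subr_ge0 (_ : _ - _ = (`|x| - M) ^+ 2); last by ring.
by rewrite real_exprn_even_ge0// realB// ger0_real.
Qed.

Local Notation m := (inf (range energy)).

Lemma inf_energy_le x : m <= energy x.
Proof. by apply: ge_inf; [case: energy_lbound|exists x]. Qed.

(** Parallelogram law: [|x - y|^2] is twice the sum of the energies of [x] and [y]
    minus four times the energy of their midpoint, which is at least the infimum. *)
Lemma dist_near_minimizers (e : R) x y :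
  energy x < m + e -> energy y < m + e ->
  `|x - y| ^+ 2 <= (4 * e)%:C%C.
Proof.
move=> xe ye; have := inf_energy_le (2^-1 *: (x + y)) => me.
have -> : `|x - y| ^+ 2 =
    (2 * energy x + 2 * energy y - 4 * energy (2^-1 *: (x + y)))%:C%C.
  rewrite !(rmorphB, rmorphD, rmorphM) /= !energyE !rmorph1.
  have -> : phi (2^-1 *: (x + y)) = 2^-1 * (phi x + phi y).
    rewrite -[_ *: _]addr0 phi_lin -[x]scale1r phi_lin !scale1r mul1r.
    have -> : phi 0 = 0.
      by apply: (addrI (phi 0)); rewrite -{1}[phi 0]mul1r -phi_lin scale1r !addr0.
    by rewrite addr0.
  rewrite -hdot !(dotBl, dotBr, dotDl, dotDr, dotZl, dotZr, rmorphM, rmorphD).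
  rewrite /= !fmorphV !rmorph_nat.
  by field.
by rewrite lecR; lra.
Qed.

(** First variation: moving from [y] in the direction [x] by the step [t] below
    lowers the energy by at least [|phi x - <x,y>|^2 / (|x|^2 + 1)], which cannot
    exceed [e]. So near-minimisers almost represent [phi]. *)
Lemma dual_dist_near_minimizer (e : R) x y : energy y < m + e ->
  `|phi x - dot x y| ^+ 2 <= e%:C%C * (`|x| ^+ 2 + 1).
Proof.
move=> ye.
(* Opaque names keep [field] from unfolding [d], [N] and the step [t]. *)
have [d dE] : exists d, d = phi x - dot x y by exists (phi x - dot x y).
have [N NE] : exists N, N = `|x| ^+ 2 + 1 by exists (`|x| ^+ 2 + 1).
rewrite -dE -NE.
have N0 : 0 < N by rewrite NE ltr_wpDl// exprn_ge0.
(* The minimising step is [d^* / |x|^2]; adding 1 to the denominator avoids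
   the case [x = 0]. *)
have [t tE] : exists t, t = N^-1 * d^* by exists (N^-1 * d^*).
have := inf_energy_le (t *: x + y); rewrite -lecR => me.
have := ye; rewrite -ltcR rmorphD /= => {}ye.
have NC : N^* = N by apply: CrealP; exact: gtr0_real.
have xx : dot x x = N - 1 by rewrite hdot NE addrK.
have Et : (energy (t *: x + y))%:C%C =
    (energy y)%:C%C - `|d| ^+ 2 / N * (1 + N^-1).
  have xy : dot x y = phi x - d by rewrite dE opprB addrC subrK.
  have tC : t^* = N^-1 * d by rewrite tE rmorphM /= fmorphV /= NC conjCK.
  rewrite !energyE phi_lin normCK !(dotDl, dotDr, dotZl, dotZr) xx.
  rewrite [dot y x]dotC xy tC !(rmorphM, rmorphD, rmorphN) /= tC tE.
  by field; exact: lt0r_neq0.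
have dN0 : 0 <= `|d| ^+ 2 / N by rewrite divr_ge0 ?exprn_ge0 // ltW.
rewrite -ler_pdivrMr //.
rewrite Et lerBrDr in me; have := le_lt_trans me ye; rewrite ltrD2l.
by move=> /ltW; apply: le_trans; rewrite ler_peMr// lerDl invr_ge0 ltW.
Qed.

Definition near_minimizers : set_system H :=
  filter_from [set e : R | 0 < e] (fun e => [set x | energy x < m + e]).

#[local] Instance near_minimizers_filter : ProperFilter near_minimizers.
Proof.
apply: filter_from_proper; last first.
  move=> e e0; have [_ [x _ <-] xe] := inf_adherent e0 energy_lbound.
  by exists x.
apply: filter_from_filter; first by exists 1; exact: ltr01.
move=> e1 e2 /= e10 e20; exists (Num.min e1 e2).
  by rewrite /= lt_min e10.
move=> x /= xe; split; apply: lt_le_trans xe _; rewrite lerD2l ge_min lexx //.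
by rewrite orbT.
Qed.

(** Completeness enters here: by the parallelogram bound the near-minimisers form
    a Cauchy filter. *)
Lemma near_minimizers_cvg : cvg near_minimizers.
Proof.
apply: cauchy_cvg; apply: cauchy_exP => eps eps0.
have [r0 epsE] : 0 < complex.Re eps /\ (complex.Re eps)%:C%C = eps.
  have -> : (complex.Re eps)%:C%C = eps by apply/RRe_real/gtr0_real.
  by rewrite -ltcR RRe_real ?gtr0_real.
move: r0 epsE; set r := complex.Re eps => r0 epsE.
(* With [e = r^2 / 8] the squared distance is at most [4 e = r^2 / 2 < r^2]. *)
have e0 : 0 < r ^+ 2 / 8 by rewrite divr_gt0 ?exprn_gt0.
have [_ [x _ <-] xe] := inf_adherent e0 energy_lbound.
exists x; exists (r ^+ 2 / 8) => // y /= ye.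
rewrite -ball_normE /= -(@ltr_pXn2r _ 2)// ?nnegrE ?(ltW eps0)//.
apply: le_lt_trans (dist_near_minimizers xe ye) _.
rewrite -epsE -rmorphXn ltcR.
have : 0 < r ^+ 2 by rewrite exprn_gt0.
by lra.
Qed.

(** Along the filter of near-minimisers [y], the numbers [<x, y>] tend to
    [phi x] by the first variation, and to [<x, lim y>] by continuity. *)
Lemma Riesz_representation : exists z, forall x, phi x = dot x z.
Proof.
exists (lim near_minimizers) => x.
have xz : dot x y @[y --> near_minimizers] --> dot x (lim near_minimizers).
  exact: (cvg_dotr hdot near_minimizers_cvg).
have xphi : dot x y @[y --> near_minimizers] --> (phi x : (R[i] : numFieldType)).
  apply/cvgrPdist_lt => eps eps0.
  have N0 : 0 < `|x| ^+ 2 + 1 :> R[i] by rewrite ltr_wpDl// exprn_ge0.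
  have e0 : 0 < eps ^+ 2 / (2 * (`|x| ^+ 2 + 1)).
    by rewrite divr_gt0 ?exprn_gt0// mulr_gt0.
  exists (complex.Re (eps ^+ 2 / (2 * (`|x| ^+ 2 + 1)))).
    by rewrite /= -ltcR RRe_real ?gtr0_real.
  move=> y /dual_dist_near_minimizer-/(_ x).
  rewrite RRe_real ?gtr0_real// => xy /=.
  rewrite -(@ltr_pXn2r _ 2)// ?nnegrE ?(ltW eps0)//.
  apply: le_lt_trans xy _.
  rewrite invfM mulrA divfK ?lt0r_neq0//.
  by rewrite ltr_pdivrMr// ltr_pMr ?exprn_gt0// ltr1n.
exact: (cvg_unique (@norm_hausdorff _ _) xphi xz).
Qed.
End Energy.
End Riesz.

(** * Adjoint of a bounded operator *)

Section Adjoint.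
Context {R : realType} {H : completeNormedModType R[i]}.
Variable dot : {dot H for Num.conj}.
Hypothesis hdot : induces_norm dot.
Variable K : {linear H -> H}.

(** A bound of a bounded operator may be any complex number (on the zero space,
    even a non-real one); its modulus plus one is a positive bound. *)
Lemma bounded_operatorP : bounded_operator K ->
  exists2 M : R[i], 0 < M & forall x, `|K x| <= M * `|x|.
Proof.
move=> [M KM]; exists (`|M| + 1) => [|x]; first by rewrite ltr_wpDl.
rewrite -[X in X <= _]normr_id; apply: le_trans (_ : `|M * `|x| | <= _).
  by rewrite !ger0_norm // (le_trans _ (KM x)).
by rewrite normrM normr_id ler_wpM2r // lerDl.
Qed.

Variable M : R[i].
Hypothesis M_gt0 : 0 < M.
Hypothesis K_le : forall x, `|K x| <= M * `|x|.

(** By Riesz representation of [x |-> <K x, y>] the set of candidates for [K^* y]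
    is inhabited, so the choice made by [adjoint] is a genuine one. *)
Lemma adjointE x y : dot (K x) y = dot x (adjoint dot K y).
Proof.
rewrite /adjoint; case: xgetP => [z _ ->//|none].
have [|||z zE] := @Riesz_representation _ _ _ hdot (fun x => dot (K x) y) (M * `|y|).
- by move=> a u v; rewrite linearP dotDl dotZl.
- by rewrite mulr_ge0 // ltW.
- move=> u; apply: le_trans (Cauchy_Schwarz hdot _ _) _.
  by rewrite mulrAC ler_wpM2r.
by case: (none z).
Qed.

Lemma adjoint_linear : linear (adjoint dot K).
Proof.
move=> a y z; apply: (dot_inj hdot) => x.
by rewrite -adjointE !(dotDr, dotZr) !adjointE.
Qed.

(** [|K^* y|^2 = <K (K^* y), y> <= M |K^* y| |y|]. *)
Lemma adjoint_norm_le y : `|adjoint dot K y| <= M * `|y|.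
Proof.
have [->|nz] := eqVneq (adjoint dot K y) 0.
  by rewrite normr0 mulr_ge0 // ltW.
have n0 : 0 < `|adjoint dot K y| by rewrite normr_gt0.
rewrite -(ler_pM2l n0) -expr2 -hdot -adjointE.
rewrite -[X in X <= _]ger0_norm; last by rewrite adjointE dot_ge0.
apply: le_trans (Cauchy_Schwarz hdot _ _) _.
by rewrite mulrA [_ * M]mulrC ler_wpM2r.
Qed.
End Adjoint.

(** * Bessel sequences and convergence of frame sums *)

Section Bessel.
Context {R : realType} {H : completeNormedModType R[i]}.
Variable dot : {dot H for Num.conj}.
Hypothesis hdot : induces_norm dot.
Variables (I : choiceType) (F : I -> H) (B : R[i]).
Hypothesis B_gt0 : 0 < B.
Hypothesis bessel : forall g (A : {fset I}),
  \sum_(i <- A) `|dot g (F i)| ^+ 2 <= B * `|g| ^+ 2.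
Implicit Types (f : H) (J : set I).

(** Let [v] be the partial sum, [a_i = <f,f_i>] and [b_i = <v,f_i>]. Then
    [2 |v|^2 = sum 2 Re (a_i conj(b_i)) <= sum (B |a_i|^2 + |b_i|^2 / B)], and the
    Bessel inequality bounds [sum |b_i|^2 / B] by [|v|^2]. The weight [B] is chosen
    so that this last term is absorbed on the left. *)
Lemma frame_partial_sum_le f (A : {fset I}) (P : pred I) :
  `|\sum_(i <- A | P i) dot f (F i) *: F i| ^+ 2 <=
  B * \sum_(i <- A | P i) `|dot f (F i)| ^+ 2.
Proof.
have [v vE] : exists v, v = \sum_(i <- A | P i) dot f (F i) *: F i by eexists.
rewrite -vE -hdot.
have vv : dot v v = \sum_(i <- A | P i) dot f (F i) * (dot v (F i))^*.
  rewrite {1}vE linear_sumlz; apply: eq_bigr => i _.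
  by rewrite -[LHS]/(dot (_ *: _) v) dotZl -dotC.
have bv : B^-1 * \sum_(i <- A | P i) `|dot v (F i)| ^+ 2 <= dot v v.
  rewrite hdot mulrC ler_pdivrMr // mulrC; apply: le_trans (bessel v A).
  by rewrite big_mkcond ler_sum // => i _; case: ifP => // _; rewrite exprn_ge0.
(* It remains to bound [2 |v|^2], one copy of which is written as a conjugate. *)
rewrite -(lerD2r (dot v v)); apply: le_trans (lerD (lexx _) bv).
rewrite {2}[dot v v]dotC vv rmorph_sum /= !mulr_sumr -!big_split /=.
apply: ler_sum => i _; rewrite rmorphM /= conjCK.
set a := dot f _; set b := dot v _.
have BC : B^* = B by apply/CrealP/gtr0_real.
rewrite -subr_ge0 [leRHS](_ : _ = `|B * a - b| ^+ 2 / B).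
  by rewrite divr_ge0 ?exprn_ge0 ?(ltW B_gt0).
rewrite !normCK rmorphB rmorphM /= BC.
by field; exact: lt0r_neq0.
Qed.

(** Once [A0] captures [sum |<f,f_i>|^2] up to [e^2 / (2 B)], every larger finite
    set adds less than [e^2 / B] to that sum, hence moves the frame sum by less than
    [e]. Restricting to [J] only drops nonnegative terms. *)
Lemma frame_sum_summable f J (L : R[i]) :
  has_sum setT (fun i => `|dot f (F i)| ^+ 2) L ->
  summable_on J (fun i => dot f (F i) *: F i).
Proof.
move=> /has_sumP fL; apply: cauchy_cvg; apply: cauchy_exP => e e0.
have d0 : 0 < e ^+ 2 / B / 2 by rewrite !divr_gt0 ?exprn_gt0.
have [A0 A0L] := fL _ d0.
exists (partial_sum_on J (fun i => dot f (F i) *: F i) A0).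
exists A0 => // A /= A0A.
rewrite -ball_normE /= distrC -(@ltr_pXn2r _ 2)// ?nnegrE ?(ltW e0)//.
rewrite partial_sum_on_fsubset //.
apply: le_lt_trans (frame_partial_sum_le _ _ _) _.
rewrite mulrC -ltr_pdivlMr//.
have := ltrD (A0L _ A0A) (A0L _ (fsubset_refl A0)).
rewrite -splitr distrC; apply: le_lt_trans.
apply: le_trans (ler_normD _ _); rewrite addrA subrK partial_sum_on_fsubset//.
rewrite ger0_norm; last by apply: sumr_ge0 => i _; rewrite exprn_ge0.
rewrite big_mkcond [leRHS]big_mkcond; apply: ler_sum => i _ /=.
rewrite in_setT; case: (i \in J) => //=; case: ifP => // _.
by rewrite exprn_ge0.
Qed.
End Bessel.

(** * Parseval frames and the identity *)

Section ParsevalFrame.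
Context {R : realType} {H : completeNormedModType R[i]}.
Variable dot : {dot H for Num.conj}.
Hypothesis hdot : induces_norm dot.
Variables (K : {linear H -> H}) (I : countType) (F : I -> H).
Hypotheses (hK : bounded_operator K) (hF : parseval_K_frame dot K F).
Implicit Types (f : H) (J : set I).

Lemma parseval_bessel : exists2 B : R[i], 0 < B & forall g (A : {fset I}),
  \sum_(i <- A) `|dot g (F i)| ^+ 2 <= B * `|g| ^+ 2.
Proof.
have [M M0 KM] := bounded_operatorP hK.
exists (M ^+ 2) => [|g A]; first by rewrite exprn_gt0.
have sR : `|adjoint dot K g| ^+ 2 \is Num.real by rewrite ger0_real ?exprn_ge0.
have := has_sum_ge_partial A (fun i => exprn_ge0 2 (normr_ge0 _)) sR (@hF g).
rewrite /partial_sum_on big_mkcond /=.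
under eq_bigr do rewrite in_setT.
move=> /le_trans; apply; rewrite -exprMn ler_sqr ?nnegrE ?mulr_ge0 ?(ltW M0) //.
exact: (adjoint_norm_le hdot M0 KM).
Qed.

Lemma parseval_summable f J : summable_on J (fun i => dot f (F i) *: F i).
Proof.
have [B B0 bessel] := parseval_bessel.
exact: (frame_sum_summable hdot B0 bessel (@hF f)).
Qed.

(** The operator [S - K K^*] is linear, and its quadratic form is
    [sum |<g,f_i>|^2 - |K^* g|^2 = 0]; polarisation concludes. *)
Lemma parseval_frame_operator f :
  has_sum setT (fun i => dot f (F i) *: F i) (K (adjoint dot K f)).
Proof.
have [M M0 KM] := bounded_operatorP hK.
pose S f := sum_on setT (fun i => dot f (F i) *: F i).
have hS g : has_sum setT (fun i => dot g (F i) *: F i) (S g).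
  exact: parseval_summable.
suff -> : K (adjoint dot K f) = S f by [].
apply/esym/eqP; rewrite -subr_eq0; apply/eqP; move: f.
apply: (eq0_of_dot_diag hdot) => [a x y|g].
  have -> : S (a *: x + y) = a *: S x + S y.
    apply: has_sum_unique (hS _) _.
    have := has_sumZD (a:=a) (hS x) (hS y); congr has_sum; apply/funext => i.
    by rewrite dotDl dotZl scalerDl scalerA.
  by rewrite (adjoint_linear hdot M0 KM) linearP scalerBr opprD addrACA.
rewrite dotBl; apply/eqP; rewrite subr_eq0; apply/eqP.
rewrite (adjointE hdot M0 KM) hdot.
apply: has_sum_unique (has_sum_dotl (y:=g) hdot (hS g)) _.
have := @hF g; congr has_sum; apply/funext => i.
by rewrite dotZl dot_normC.
Qed.
End ParsevalFrame.

Theorem theorem2p4 (R : realType) (H : completeNormedModType R[i])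
    (dot : {dot H for Num.conj}) (K : {linear H -> H})
    (I : countType) (F : I -> H)
    (hdot : induces_norm dot) (hsep : separable H)
    (hK : bounded_operator K) (hF : parseval_K_frame dot K F)
    (f : H) (J E : set I) (hE : E `<=` ~` J) :
  let u := fun i => dot f (F i) *: F i in
  let c := fun i => dot f (F i) * Num.conj (dot (K (adjoint dot K f)) (F i)) in
  [/\ summable_on (J `|` E) u,
      summable_on (~` J `\` E) u,
      summable_on J u,
      summable_on (~` J) u
    & summable_on E c] /\
  `|sum_on (J `|` E) u| ^+ 2 - `|sum_on (~` J `\` E) u| ^+ 2
  = `|sum_on J u| ^+ 2 - `|sum_on (~` J) u| ^+ 2
    + 2 * 'Re (sum_on E c).
Proof.
move=> u c; have us D : summable_on D u by exact: (parseval_summable hdot hK hF).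
have JE : [disjoint J & E] by apply/disj_setPS => i [iJ /hE].
have EJ' : [disjoint E & ~` J `\` E] by apply/disj_setPS => i [iE [_]].
have JJ' : [disjoint J & ~` J] by apply/disj_setPS => i [].
have JU : has_sum (J `|` E) u _ := has_sumU JE (us J) (us E).
have JCU : has_sum (~` J) u (sum_on E u + sum_on (~` J `\` E) u).
  rewrite -[X in has_sum X](setDUK hE).
  exact: has_sumU (us _) (us _).
have TU : K (adjoint dot K f) = sum_on J u + (sum_on E u + sum_on (~` J `\` E) u).
  apply: has_sum_unique (parseval_frame_operator (f:=f) hdot hK hF) _.
  by rewrite -[X in has_sum X](setUCr J); exact: has_sumU JJ' (us J) JCU.
have cs : has_sum E c (dot (sum_on E u) (K (adjoint dot K f))).
  have := has_sum_dotl (y:=K (adjoint dot K f)) hdot (us E).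
  by congr has_sum; apply/funext => i; rewrite dotZl /c -dotC.
split.
  split; [exact: us | exact: us | exact: us | exact: us |].
  by apply: cvgP cs.
rewrite (has_sum_sum_on JU) (has_sum_sum_on JCU) (has_sum_sum_on cs) TU.
set a := sum_on J u; set b := sum_on E u; set d := sum_on _ u.
(* Everything is now an identity between inner products of [a], [b] and [d]. *)
rewrite ReE mulrC divfK ?pnatr_eq0// -dotC -!hdot.
rewrite !(dotDl, dotDr).
by ring.
Qed.
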